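(* It is undecidable, given a HyperTSL formula $\varphi$, whether $\varphi$ describes a pseudo hyperproperty.
   Context: TSL setting. Let $\mathcal V$ be a set of values with Booleans $\mathbb B$. Fix inputs $\mathbb I$, cells $\mathbb C$, function symbols $\Sigma_F$ and predicate symbols $\Sigma_P\subseteq\Sigma_F$. Function terms: $\tau::=s\mid f\,\tau_1\cdots\tau_n$ ($s\in\mathbb I\cup\mathbb C$), forming $\mathcal T_F$; predicate terms $p\,\tau_1\cdots\tau_n$; update terms $[c\leftarrow\tau]$. An interpretation $\langle\cdot\rangle$ maps symbols to functions $\mathcal V^n\to\mathcal V$ (predicates into $\mathbb B$). A computation is an infinite sequence $\varsigma$ of total maps $\mathbb C\to\mathcal T_F$; an input stream is an infinite sequence $\iota$ of maps $\mathbb I\to\mathcal V$; an execution is $(\varsigma,\iota)$. With initial values $\mathrm{init}_c$, evaluation: $\eta(\varsigma,\iota,i,s)=\iota(i)(s)$ for inputs; $\mathrm{init}_s$ for cells at $i=0$; $\eta(\varsigma,\iota,i-1,\varsigma(i-1)(s))$ for cells at $i>0$; $\eta(\varsigma,\iota,i,f\tau_1\cdots\tau_n)=\langle f\rangle(\eta(\cdot,\tau_1),\dots)$. HyperTSL: $\varphi::=\forall\pi.\varphi\mid\exists\pi.\varphi\mid\psi$, $\psi::=\neg\psi\mid\psi\wedge\psi\mid X\psi\mid\psi U\psi\mid(\tau^p)_\pi\mid[c\leftarrow\tau]_\pi$. For a set $E$ of executions, assignment $\Pi$ of trace variables to $E$, time $i$: $[c\leftarrow\tau]_\pi$ holds iff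 $\varsigma(i)(c)$ is syntactically $\tau$ where $(\varsigma,\iota)=\Pi(\pi)$; $(\tau^p)_\pi$ iff $\eta(\varsigma,\iota,i,\tau^p)$ is true; LTL semantics for the connectives; quantifiers range over $E$. $E\models_{\langle\cdot\rangle}\varphi$ iff $\varphi$ holds at time 0 with empty assignment. Pseudo hyperproperty: a HyperTSL formula $\varphi$ describes a pseudo hyperproperty iff for every interpretation $\langle\cdot\rangle$ there is a set $P$ of executions such that for every set $E$ of executions, $E\models_{\langle\cdot\rangle}\varphi$ iff $E\subseteq P$. *)

(* Defs.v *)
From HB Require Import structures.
From mathcomp Require Import all_boot.

Set Implicit Arguments.
Unset Strict Implicit.
Unset Printing Implicit Defensive.

(* Inputs, cells and trace variables are named by natural numbers.  The symbols
   Sigma_F are the pairs of a [symbol] and an arity, the arity being the number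
   of arguments the symbol is applied to; Sigma_P is the part built on [Pred].
   So every finite set of inputs, cells and symbols occurs up to renaming. *)
Inductive symbol := Fun of nat | Pred of nat.

Unset Elimination Schemes.
Inductive term :=
  | Input of nat
  | Cell of nat
  | App of symbol & seq term.
Set Elimination Schemes.

(* [Test p ts x] is (p ts)_x and [Upd c t x] is [c <- t]_x. *)
Inductive body :=
  | Not of body
  | And of body & body
  | Next of body
  | Until of body & body
  | Test of nat & seq term & nat
  | Upd of nat & term & nat.

Inductive formula :=
  | Forall of nat & formula
  | Exists of nat & formula
  | Body of body.

Fixpoint body_vars (psi : body) : seq nat :=
  match psi with
  | Not p => body_vars p
  | And p q => body_vars p ++ body_vars q
  | Next p => body_vars p
  | Until p q => body_vars p ++ body_vars q
  | Test _ _ x => [:: x]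
  | Upd _ _ x => [:: x]
  end.

Fixpoint free_vars (phi : formula) : seq nat :=
  match phi with
  | Forall x p => [seq y <- free_vars p | y != x]
  | Exists x p => [seq y <- free_vars p | y != x]
  | Body psi => body_vars psi
  end.

(* A formula is evaluated under the empty trace assignment, so the formulas in
   question are the closed ones. *)
Definition sentence := {phi : formula | nilp (free_vars phi)}.

(* [V] is the set of values and [B : bool -> V] the inclusion of the Booleans.
   A map [seq V -> V] is a family of maps V^n -> V, one for each arity n. *)
Record interpretation (V : Type) (B : bool -> V) := Interpretation {
  apply_symbol :> symbol -> seq V -> V;
  pred_boolean : forall p vs, exists b, apply_symbol (Pred p) vs = B b
}.

Definition computation := nat -> nat -> term.

Definition input_stream (V : Type) := nat -> nat -> V.

Definition execution (V : Type) := (computation * input_stream V)%type.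

Fixpoint term_value (V : Type) (sym : symbol -> seq V -> V)
    (inputs cells : nat -> V) (t : term) : V :=
  match t with
  | Input s => inputs s
  | Cell c => cells c
  | App f ts => sym f (map (term_value sym inputs cells) ts)
  end.

Fixpoint eta (V : Type) (sym : symbol -> seq V -> V) (init : nat -> V)
    (sigma : computation) (iota : input_stream V) (i : nat) (t : term) : V :=
  term_value sym (iota i)
    (fun c => if i is j.+1 then eta sym init sigma iota j (sigma j c)
              else init c) t.

Definition assignment (V : Type) := nat -> option (execution V).

Definition empty_assignment (V : Type) : assignment V := fun=> None.

Definition assign (V : Type) (Pi : assignment V) (x : nat) (e : execution V) :
  assignment V := fun y => if y == x then Some e else Pi y.

Fixpoint body_holds (V : Type) (B : bool -> V) (I : interpretation B)
    (init : nat -> V) (Pi : assignment V) (i : nat) (psi : body) : Prop :=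
  match psi with
  | Not p => ~ body_holds I init Pi i p
  | And p q => body_holds I init Pi i p /\ body_holds I init Pi i q
  | Next p => body_holds I init Pi i.+1 p
  | Until p q => exists j, [/\ i <= j, body_holds I init Pi j q &
      forall k, i <= k < j -> body_holds I init Pi k p]
  | Test p ts x =>
      if Pi x is Some (sigma, iota)
      then eta I init sigma iota i (App (Pred p) ts) = B true else False
  | Upd c t x =>
      if Pi x is Some (sigma, iota) then sigma i c = t else False
  end.

Fixpoint holds (V : Type) (B : bool -> V) (I : interpretation B)
    (init : nat -> V) (E : execution V -> Prop) (Pi : assignment V)
    (phi : formula) : Prop :=
  match phi with
  | Forall x p => forall e, E e -> holds I init E (assign Pi x e) p
  | Exists x p => exists e, E e /\ holds I init E (assign Pi x e) p
  | Body psi => body_holds I init Pi 0 psi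
  end.

Definition models (V : Type) (B : bool -> V) (I : interpretation B)
    (init : nat -> V) (E : execution V -> Prop) (phi : formula) : Prop :=
  holds I init E (@empty_assignment V) phi.

Definition pseudo_hyperproperty (V : Type) (B : bool -> V) (init : nat -> V)
    (phi : formula) : Prop :=
  forall I : interpretation B, exists P : execution V -> Prop,
  forall E : execution V -> Prop,
    models I init E phi <-> (forall e, E e -> P e).

Inductive move := MoveL | MoveR.

(* Deterministic single-tape machines with input alphabet [A].  The tape
   alphabet is [option (A + tm_work)], with [None] the blank.  [tm_verdict q] is
   [Some true] in accepting, [Some false] in rejecting and [None] in all other
   states. *)
Record turing_machine (A : finType) := TuringMachine {
  tm_state : finType;
  tm_work : finType;
  tm_start : tm_state;
  tm_verdict : tm_state -> option bool;
  tm_delta : tm_state -> option (A + tm_work) ->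
             tm_state * option (A + tm_work) * move
}.

(* The tape is infinite to the right; a left move from square 0 stays there. *)
Record tm_config (A : finType) (M : turing_machine A) := TMConfig {
  cfg_state : tm_state M;
  cfg_head : nat;
  cfg_tape : nat -> option (A + tm_work M)
}.

Definition tm_init (A : finType) (M : turing_machine A) (w : seq A) :
    tm_config M :=
  TMConfig (tm_start M) 0
    (fun k => nth None [seq Some (inl a : A + tm_work M) | a <- w] k).

Definition tm_step (A : finType) (M : turing_machine A) (c : tm_config M) :
    tm_config M :=
  if tm_verdict (cfg_state c) is Some _ then c else
  let: (q, s, m) := tm_delta (cfg_state c) (cfg_tape c (cfg_head c)) in
  TMConfig q
    (match m with MoveL => (cfg_head c).-1 | MoveR => (cfg_head c).+1 end)
    (fun k => if k == cfg_head c then s else cfg_tape c k).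

Definition tm_outputs (A : finType) (M : turing_machine A) (w : seq A)
    (b : bool) : Prop :=
  exists n, tm_verdict (cfg_state (iter n (@tm_step A M) (tm_init M w))) = Some b.

Definition tm_decidable (A : finType) (X : Type) (enc : X -> seq A)
    (P : X -> Prop) : Prop :=
  exists M : turing_machine A, forall x,
    (P x -> tm_outputs M (enc x) true) /\ (~ P x -> tm_outputs M (enc x) false).

Inductive letter :=
  | LForall | LExists | LNot | LAnd | LNext | LUntil | LTest | LUpd
  | LInput | LCell | LApp | LFun | LPred | LTick | LEnd.

Definition letters : seq letter :=
  [:: LForall; LExists; LNot; LAnd; LNext; LUntil; LTest; LUpd;
      LInput; LCell; LApp; LFun; LPred; LTick; LEnd].

Definition letter_rank (l : letter) : nat :=
  match l with
  | LForall => 0 | LExists => 1 | LNot => 2 | LAnd => 3 | LNext => 4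
  | LUntil => 5 | LTest => 6 | LUpd => 7 | LInput => 8 | LCell => 9
  | LApp => 10 | LFun => 11 | LPred => 12 | LTick => 13 | LEnd => 14
  end.

Lemma letter_rank_lt l : letter_rank l < 15.
Proof. by case: l. Qed.

Lemma letter_rankK : cancel (fun l => Ordinal (letter_rank_lt l))
  (fun i : 'I_15 => nth LEnd letters i).
Proof. by case. Qed.

HB.instance Definition _ := Finite.copy letter (can_type letter_rankK).

Definition enc_nat (n : nat) : seq letter := rcons (nseq n LTick) LEnd.

Definition enc_symbol (f : symbol) : seq letter :=
  match f with
  | Fun n => LFun :: enc_nat n
  | Pred n => LPred :: enc_nat n
  end.

Fixpoint enc_term (t : term) : seq letter :=
  match t with
  | Input s => LInput :: enc_nat s
  | Cell c => LCell :: enc_nat c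
  | App f ts => LApp :: enc_symbol f ++ enc_nat (size ts) ++
                flatten (map enc_term ts)
  end.

Fixpoint enc_body (psi : body) : seq letter :=
  match psi with
  | Not p => LNot :: enc_body p
  | And p q => LAnd :: enc_body p ++ enc_body q
  | Next p => LNext :: enc_body p
  | Until p q => LUntil :: enc_body p ++ enc_body q
  | Test p ts x => LTest :: enc_nat p ++ enc_nat (size ts) ++
                  flatten (map enc_term ts) ++ enc_nat x
  | Upd c t x => LUpd :: enc_nat c ++ enc_term t ++ enc_nat x
  end.

Fixpoint enc_formula (phi : formula) : seq letter :=
  match phi with
  | Forall x p => LForall :: enc_nat x ++ enc_formula p
  | Exists x p => LExists :: enc_nat x ++ enc_formula p
  | Body psi => enc_body psi
  end.

Definition enc_sentence (phi : sentence) : seq letter := enc_formula (sval phi).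

Fixpoint term_ind (P : term -> Prop) (HI : forall s, P (Input s))
    (HC : forall c, P (Cell c))
    (HA : forall f ts, foldr (fun t => and (P t)) True ts -> P (App f ts))
    (t : term) : P t :=
  match t with
  | Input s => HI s
  | Cell c => HC c
  | App f ts => HA f ts
      ((fix all_ts ts : foldr (fun t => and (P t)) True ts :=
          if ts is u :: us then conj (term_ind HI HC HA u) (all_ts us)
          else Logic.I) ts)
  end.

Lemma enc_nat_prefix m n (u v : seq letter) :
  enc_nat m ++ u = enc_nat n ++ v -> m = n /\ u = v.
Proof.
rewrite /enc_nat.
by elim: m n => [|m IH] [|n] //= [] => [->|/IH[-> ->]].
Qed.

Lemma enc_symbol_prefix f g (u v : seq letter) :
  enc_symbol f ++ u = enc_symbol g ++ v -> f = g /\ u = v.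
Proof. by case: f => m; case: g => n //= [] /enc_nat_prefix[-> ->]. Qed.

Lemma enc_terms_prefix ts us (u v : seq letter) :
  foldr (fun t => and (forall t' (u v : seq letter),
    enc_term t ++ u = enc_term t' ++ v -> t = t' /\ u = v)) True ts ->
  enc_nat (size ts) ++ flatten (map enc_term ts) ++ u =
  enc_nat (size us) ++ flatten (map enc_term us) ++ v -> ts = us /\ u = v.
Proof.
move=> H /enc_nat_prefix[].
elim: ts us H => [|t ts IH] [|t' us] //= [Ht Hts] [Hsz].
by rewrite -!catA => /Ht[-> /(IH _ Hts Hsz)[-> ->]].
Qed.

Lemma enc_term_prefix t t' (u v : seq letter) :
  enc_term t ++ u = enc_term t' ++ v -> t = t' /\ u = v.
Proof.
elim: t t' u v => [s|c|f ts IH] [s'|c'|g us] u v //= [].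
- by move=> /enc_nat_prefix[-> ->].
- by move=> /enc_nat_prefix[-> ->].
- rewrite -!catA => /enc_symbol_prefix[->].
  by move=> /(enc_terms_prefix IH)[-> ->].
Qed.

Lemma enc_body_prefix p q (u v : seq letter) :
  enc_body p ++ u = enc_body q ++ v -> p = q /\ u = v.
Proof.
elim: p q u v => [p IH|p IH p' IH'|p IH|p IH p' IH'|a ts x|c t x]
  [q|q q'|q|q q'|b us y|d t' y] u v //= []; rewrite -?catA.
- by move=> /IH[-> ->].
- by move=> /IH[-> /IH'[-> ->]].
- by move=> /IH[-> ->].
- by move=> /IH[-> /IH'[-> ->]].
- move=> /enc_nat_prefix[-> /enc_terms_prefix[]].
    by elim: ts => //= t ts IH; split=> // *; apply: enc_term_prefix.
  by move=> -> /enc_nat_prefix[-> ->].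
- by move=> /enc_nat_prefix[-> /enc_term_prefix[-> /enc_nat_prefix[-> ->]]].
Qed.

Lemma enc_formula_inj : injective enc_formula.
Proof.
elim=> [x p IH|x p IH|p] [y q|y q|q] //=.
- by case=> /enc_nat_prefix[-> /IH->].
- by case: q.
- by case=> /enc_nat_prefix[-> /IH->].
- by case: q.
- by case: p.
- by case: p.
- by rewrite -[enc_body p]cats0 -[enc_body q]cats0 => /enc_body_prefix[->].
Qed.

Lemma enc_sentence_inj : injective enc_sentence.
Proof. by move=> p q /enc_formula_inj/val_inj. Qed.

(* Main.v *)
Require Import Defs.
From Stdlib Require Import Classical.
From mathcomp Require Import all_boot.

(* A Turing machine [M] deciding the property is defeated by a sentence that
   describes the run of [M] on its own code.  A trace stores a configuration of
   a stack machine, and the sentence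

     forall x exists y exists z, y is the successor of x, x does not reject,
                                 and z is the start configuration

   has a nonempty model iff the stack machine never rejects; every nonempty
   model contains a start configuration and its successor, which differ, so a
   nonempty model spoils closure under subsets.  The stack machine starts from
   the code of the sentence without its last conjunct, which spells out that
   very code letter by letter; it rebuilds the code of the whole sentence by
   quoting the letters and then runs [M] on it. *)

Set Implicit Arguments.
Unset Strict Implicit.
Unset Printing Implicit Defensive.

(** * Derived connectives and their semantics *)

Definition Verum : body := Not (And (Upd 0 (Cell 0) 0) (Not (Upd 0 (Cell 0) 0))).
Definition Imp (p q : body) : body := Not (And p (Not q)).
Definition Always (p : body) : body := Not (Until Verum (Not p)).
Definition Conj (ps : seq body) : body := foldr And Verum ps.

Section BodySemantics.

Variables (V : Type) (B : bool -> V) (I : interpretation B) (init : nat -> V).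
Variable Pi : assignment V.

Local Notation sat := (body_holds I init Pi).

Lemma sat_Verum i : sat i Verum.
Proof. by case. Qed.

Lemma sat_And i p q : sat i (And p q) <-> sat i p /\ sat i q.
Proof. by []. Qed.

Lemma sat_Imp i p q : sat i (Imp p q) <-> (sat i p -> sat i q).
Proof.
split=> [h hp|h [hp]]; last by apply; apply: h.
by apply: NNPP => hq; apply: h.
Qed.

Lemma sat_Always i p : sat i (Always p) <-> forall j, sat (i + j) p.
Proof.
split=> [h j|h [j [le_ij]]].
  apply: NNPP => hj; apply: h; exists (i + j); split=> //.
    exact: leq_addr.
  by move=> k _; exact: sat_Verum.
by rewrite -(subnKC le_ij) => hj _; exact: hj (h _).
Qed.

Lemma sat_Next n i p : sat i (iter n Next p) <-> sat (i + n) p.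
Proof. by elim: n i => [|n IH] i /=; rewrite ?addn0 // IH addSnnS. Qed.

Lemma sat_Conj_map (T : eqType) i (f : T -> body) (ts : seq T) :
  sat i (Conj (map f ts)) <-> forall t, t \in ts -> sat i (f t).
Proof.
elim: ts => [|t ts IH] /=; first by split=> // _; exact: sat_Verum.
rewrite IH; split=> [[ht hts] u|h].
  by rewrite inE => /predU1P[->|/hts].
split; first by apply: h; rewrite mem_head.
by move=> u uts; apply: h; rewrite inE uts orbT.
Qed.

Lemma sat_Conj_enum (T : finType) i (f : T -> body) :
  sat i (Conj (map f (enum T))) <-> forall t, sat i (f t).
Proof.
rewrite sat_Conj_map; split=> [h t|h t _]; last exact: h.
by apply: h; rewrite mem_enum.
Qed.

End BodySemantics.

(** The empty conjunction is [Verum], which mentions variable [0]; hence the hypothesis [a 0]. *)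
Lemma body_vars_Conj (T : Type) (a : pred nat) (f : T -> body) ts :
  a 0 -> (forall t, all a (body_vars (f t))) -> all a (body_vars (Conj (map f ts))).
Proof. by move=> a0 af; elim: ts => [|t ts IH] /=; rewrite ?a0 // all_cat af. Qed.

Lemma body_vars_Next n p : body_vars (iter n Next p) = body_vars p.
Proof. by elim: n. Qed.

(** * Stack machines described by formulas *)

(* One step of a stack machine replaces the top symbol of every stack by a word;
   the words depend on the tops of all stacks.  Control states are kept on a
   stack of their own. *)
Section StackMachine.

Variables S G : finType.
Variable delta : {ffun S -> option G} -> S -> seq G.
Variable bad : pred {ffun S -> option G}.

Definition tops (l : {ffun S -> seq G}) : {ffun S -> option G} :=
  [ffun s => ohead (l s)].

Definition stack_step (l : {ffun S -> seq G}) : {ffun S -> seq G} :=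
  [ffun s => delta (tops l) s ++ behead (l s)].

(* A trace stores a stack along time: at time [i] the cell of stack [s] is
   updated with the code of the symbol at depth [i]. *)
Definition reads (s : S) (o : option G) (x : nat) : body :=
  Upd (pickle s) (Cell (pickle o)) x.

(** The continuation [p] sits innermost, so in prefix code each symbol of [w] contributes one
    contiguous block, independent of the others. *)
Definition spells (s : S) (w : seq G) (x : nat) (p : body) : body :=
  foldr (fun g q => And (reads s (Some g) x) (Next q)) p w.

(** The code of [None] from depth [size w] on fixes the length of the stack. *)
Definition stack_is (s : S) (w : seq G) (x : nat) : body :=
  spells s w x (Always (reads s None x)).

(** The second conjunct copies depth [j.+1] of [x] to depth [size w + j] of [y], which drops the old
    top; [None] is copied too, so the end of the stack carries over. *)
Definition pushed (s : S) (w : seq G) (x y : nat) : body :=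
  And (spells s w y Verum)
    (Always (Conj [seq Imp (Next (reads s o x)) (iter (size w) Next (reads s o y))
                  | o <- enum {: option G}])).

Definition successor (x y : nat) : body :=
  Conj [seq Imp (Conj [seq reads s (t s) x | s <- enum S])
            (if bad t then Not Verum
             else Conj [seq pushed s (delta t s) x y | s <- enum S])
       | t : {ffun S -> option G} <- enum {: {ffun S -> option G}}].

Definition represents (V : Type) (e : execution V) (s : S) (w : seq G) : Prop :=
  forall i, e.1 i (pickle s) = Cell (pickle (onth w i)).

Definition trace_of (V : Type) (v : V) (l : {ffun S -> seq G}) : execution V :=
  (fun i c => Cell (if unpickle c is Some s then pickle (onth (l s) i) else 0),
   fun _ _ => v).

Lemma trace_of_represents (V : Type) (v : V) l s :
  represents (trace_of v l) s (l s).
Proof. by move=> i; rewrite /= pickleK. Qed.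

Lemma represents_inj (V : Type) (e : execution V) s w w' :
  represents e s w -> represents e s w' -> w = w'.
Proof.
move=> h h'.
apply: eq_from_onth => i.
by have := h i; rewrite h' => -[/(pcan_inj pickleK)].
Qed.

Lemma body_vars_spells (a : pred nat) s w x p :
  a x -> all a (body_vars p) -> all a (body_vars (spells s w x p)).
Proof. by move=> ax ap; elim: w => //= g w; rewrite ax. Qed.

Lemma body_vars_stack_is (a : pred nat) s w x :
  a 0 -> a x -> all a (body_vars (stack_is s w x)).
Proof. by move=> a0 ax; apply: body_vars_spells => //=; rewrite a0 ax. Qed.

Lemma body_vars_successor (a : pred nat) x y :
  a 0 -> a x -> a y -> all a (body_vars (successor x y)).
Proof.
move=> a0 ax ay; apply: body_vars_Conj => // t /=.
rewrite all_cat body_vars_Conj //=; last by move=> s; rewrite ax.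
case: ifP => _ /=; first by rewrite a0.
apply: body_vars_Conj => // s /=; rewrite all_cat body_vars_spells //= a0 //=.
by apply: body_vars_Conj => // o /=; rewrite body_vars_Next /= ax ay.
Qed.

Section Semantics.

Variables (V : Type) (B : bool -> V) (I : interpretation B) (init : nat -> V).
Variable Pi : assignment V.

Local Notation sat := (body_holds I init Pi).

Lemma sat_reads e x s o i : Pi x = Some e ->
  sat i (reads s o x) <-> e.1 i (pickle s) = Cell (pickle o).
Proof. by rewrite /= => ->; case: e. Qed.

Lemma sat_spells e x s w p i : Pi x = Some e ->
  sat i (spells s w x p) <->
  (forall j, j < size w -> e.1 (i + j) (pickle s) = Cell (pickle (onth w j))) /\
  sat (i + size w) p.
Proof.
move=> xe; elim: w i => [|g w IH] i; first by rewrite addn0; split=> [|[]].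
have -> : spells s (g :: w) x p =
  And (reads s (Some g) x) (iter 1 Next (spells s w x p)) by [].
rewrite sat_And sat_Next (sat_reads _ _ _ xe) IH addn1 addSnnS.
split=> [[h0 [hS hp]]|[h hp]].
  by split=> // -[|j] hj; rewrite ?addn0 // -addSnnS hS.
split; first by have := h 0; rewrite addn0; apply.
by split=> // j hj; rewrite addSnnS h.
Qed.

Lemma sat_stack_is e x s w : Pi x = Some e ->
  sat 0 (stack_is s w x) <-> represents e s w.
Proof.
move=> xe; rewrite (sat_spells _ _ _ _ xe) sat_Always add0n.
split=> [[h hN] i|h].
  have [/h//|le_wi] := ltnP i (size w).
  by rewrite -(subnKC le_wi); have /(sat_reads _ _ _ xe)-> := hN (i - size w);
     rewrite onth_default // leq_addr.
split=> [j _|j]; first exact: h.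
by apply/(sat_reads _ _ _ xe); rewrite h onth_default // leq_addr.
Qed.

Lemma sat_pushed ex ey x y s u w : Pi x = Some ex -> Pi y = Some ey ->
  represents ex s u ->
  sat 0 (pushed s w x y) <-> represents ey s (w ++ behead u).
Proof.
move=> xe ye eu.
(* Both sides are [None] when [u] is empty. *)
have onth_tail j : onth (w ++ behead u) (size w + j) = onth u j.+1.
  by rewrite onth_cat ltnNge leq_addr addKn; case: (u) => //=; case: j.
rewrite sat_And (sat_spells _ _ _ _ ye) sat_Always.
split=> [[[hw _] ht] i|h].
  have [lt_iw|le_wi] := ltnP i (size w).
    by rewrite onth_cat lt_iw; exact: hw.
  rewrite -(subnKC le_wi) onth_tail; set j := i - size w.
  have /sat_Conj_enum/(_ (onth u j.+1))/sat_Imp := ht j.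
  rewrite sat_Next add0n addnC (sat_reads _ _ _ ye); apply.
  by apply/(sat_reads _ _ _ xe); rewrite eu.
split; first split.
- by move=> j lt_jw; rewrite add0n h onth_cat lt_jw.
- exact: sat_Verum.
move=> j; apply/sat_Conj_enum => o; apply/sat_Imp.
rewrite sat_Next add0n => hx; apply/(sat_reads _ _ _ ye); rewrite addnC h onth_tail.
by rewrite -eu; apply/(sat_reads _ _ _ xe).
Qed.

Lemma sat_successor ex ey x y (l : {ffun S -> seq G}) : Pi x = Some ex -> Pi y = Some ey ->
  (forall s, represents ex s (l s)) ->
  sat 0 (successor x y) <->
  ~~ bad (tops l) /\ (forall s, represents ey s (stack_step l s)).
Proof.
move=> xe ye el; rewrite sat_Conj_enum.
have tops_reads (t : {ffun S -> option G}) :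
    sat 0 (Conj [seq reads s (t s) x | s <- enum S]) <-> t = tops l.
  rewrite sat_Conj_enum; split=> [h|-> s].
    apply/ffunP => s; have /(sat_reads _ _ _ xe) := h s.
    by rewrite el ffunE => -[/(pcan_inj pickleK)<-]; case: (l s).
  by apply/(sat_reads _ _ _ xe); rewrite el ffunE; case: (l s).
split=> [h|[/negPf nbad h] t].
  (* Only the implication for the actual tops of [l] has a true premise. *)
  have /sat_Imp := h (tops l); rewrite tops_reads => /(_ erefl).
  case: ifP => _ => [nV|]; first by have /nV := @sat_Verum _ _ I init Pi 0.
  rewrite sat_Conj_enum => {}h; split=> // s; rewrite ffunE.
  exact/(sat_pushed _ xe ye (el s)).
apply/sat_Imp => /tops_reads->; rewrite nbad; apply/sat_Conj_enum => s.
by apply/(sat_pushed _ xe ye (el s)); have := h s; rewrite ffunE.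
Qed.

End Semantics.

End StackMachine.

Lemma enc_spells (S G : finType) (s : S) (w : seq G) x p :
  enc_body (spells s w x p) =
  flatten [seq LAnd :: rcons (enc_body (reads s (Some g) x)) LNext | g <- w]
  ++ enc_body p.
Proof. by elim: w => //= g w ->; rewrite cat_rcons -!catA. Qed.

(** * The machine that rebuilds a code and runs [M] on it *)

Section Diagonal.

Variable M : turing_machine letter.

Local Notation work_symbol := (option (letter + tm_work M)).

Definition control : finType := (bool * bool + tm_state M)%type.
Definition stack : finType := option (bool * bool).
Definition stack_symbol : finType := (control + work_symbol)%type.

Definition boot : control := inl (false, false).
Definition copying : control := inl (false, true).
Definition quoting : control := inl (true, false).
Definition joining : control := inl (true, true).
Definition running (q : tm_state M) : control := inr q.

(** The left and right stacks hold the tape before the head and from the head on; of the two copies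
    of the input, one is to be quoted and one written verbatim. *)
Definition control_stack : stack := None.
Definition left_stack : stack := Some (false, false).
Definition copy1_stack : stack := Some (false, true).
Definition copy2_stack : stack := Some (true, false).
Definition right_stack : stack := Some (true, true).

Definition words (q : control) (a b c r : seq work_symbol) (s : stack) :
    seq stack_symbol :=
  match s with
  | None => [:: inl q]
  | Some (false, false) => map inr a
  | Some (false, true) => map inr b
  | Some (true, false) => map inr c
  | Some (true, true) => map inr r
  end.

Definition config q a b c r : {ffun stack -> seq stack_symbol} :=
  finfun (words q a b c r).

Definition tape_letter (x : letter) : work_symbol := Some (inl x).

(** The block that one symbol contributes in [enc_spells], for the left stack of trace variable
    [2]. *)
Definition quote (g : stack_symbol) : seq letter :=
  LAnd :: rcons (enc_body (reads left_stack (Some g) 2)) LNext.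

Definition end_code : seq letter :=
  enc_body (Always (reads left_stack (None : option stack_symbol) 2)).

(* Started with [w] on the left stack, the machine writes [w], the quotation of
   [w] and [end_code] on the right stack and then runs [M] on them. *)
Definition instruction (q : control) (a b c r : option work_symbol) :
    stack -> seq stack_symbol :=
  let keep := @seq_of_opt work_symbol in
  match q with
  | inl (false, false) =>
      words copying (keep a) (keep b) (keep c) (map tape_letter end_code)
  | inl (false, true) =>
      if a is Some g then words copying [::] (g :: keep b) (g :: keep c) (keep r)
      else words quoting (keep a) (keep b) (keep c) (keep r)
  | inl (true, false) =>
      if b is Some g then
        words quoting (keep a) [::] (keep c)
          (map tape_letter (quote (inr g)) ++ keep r)
      else words joining (keep a) (keep b) (keep c) (keep r)
  | inl (true, true) =>
      if c is Some g then words joining (keep a) (keep b) [::] (g :: keep r)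
      else words (running (tm_start M)) (keep a) (keep b) (keep c) (keep r)
  | inr p =>
      if tm_verdict p is Some _ then words q (keep a) (keep b) (keep c) (keep r)
      else let: (p', g, m) := tm_delta p (odflt None r) in
      match m with
      | MoveL => words (running p') [::] (keep b) (keep c) (rcons (keep a) g)
      | MoveR => words (running p') (g :: keep a) (keep b) (keep c) [::]
      end
  end.

Definition work_top (o : option stack_symbol) : option work_symbol :=
  if o is Some (inr g) then Some g else None.

Definition program (t : {ffun stack -> option stack_symbol}) :
    stack -> seq stack_symbol :=
  if t control_stack is Some (inl q) then
    instruction q (work_top (t left_stack)) (work_top (t copy1_stack))
      (work_top (t copy2_stack)) (work_top (t right_stack))
  else fun=> [::].

Definition rejecting (t : {ffun stack -> option stack_symbol}) : bool :=
  if t control_stack is Some (inl (inr q)) then tm_verdict q == Some false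
  else false.

Local Notation step := (stack_step program).

Lemma step_config q a b c r q' a' b' c' r' :
  instruction q (ohead a) (ohead b) (ohead c) (ohead r) = words q' a' b' c' r' ->
  step (config q a b c r) =
  config q' (a' ++ behead a) (b' ++ behead b) (c' ++ behead c) (r' ++ behead r).
Proof.
have work_topE (w : seq work_symbol) : work_top (ohead (map inr w)) = ohead w.
  by case: w.
move=> instrE; apply/ffunP => s; rewrite !ffunE /program !ffunE /=.
rewrite !work_topE instrE.
by case: s => [[[] []]|] //=; rewrite map_cat behead_map.
Qed.

Lemma seq_of_opt_ohead (T : Type) (w : seq T) : seq_of_opt (ohead w) ++ behead w = w.
Proof. by case: w. Qed.

(** Popping reverses the word; the two later phases pop the reversed copies in turn, which restores
    the order in front of [r]. *)
Lemma copying_run a b c r : exists n, iter n step (config copying a b c r) =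
  config quoting [::] (rev a ++ b) (rev a ++ c) r.
Proof.
elim: a b c => [|g a IH] b c.
  (* An exhausted left stack costs one step, which only changes the phase. *)
  by exists 1; rewrite /= (@step_config copying [::] b c r _ _ _ _ _ erefl) /= !seq_of_opt_ohead.
have [n nE] := IH (g :: b) (g :: c); exists n.+1.
rewrite iterSr (@step_config copying (g :: a) b c r _ _ _ _ _ erefl) /= !seq_of_opt_ohead nE.
by rewrite rev_cons !cat_rcons.
Qed.

Lemma quoting_run a b c r : exists n, iter n step (config quoting a b c r) =
  config joining a [::] c
    (flatten [seq map tape_letter (quote (inr g)) | g <- rev b] ++ r).
Proof.
elim: b r => [|g b IH] r.
  by exists 1; rewrite /= (@step_config quoting a [::] c r _ _ _ _ _ erefl) /= !seq_of_opt_ohead.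
have [n nE] := IH (map tape_letter (quote (inr g)) ++ r); exists n.+1.
rewrite iterSr (@step_config quoting a (g :: b) c r _ _ _ _ _ erefl).
rewrite -catA !seq_of_opt_ohead nE.
by rewrite rev_cons map_rcons flatten_rcons catA.
Qed.

Lemma joining_run a b c r : exists n, iter n step (config joining a b c r) =
  config (running (tm_start M)) a b [::] (rev c ++ r).
Proof.
elim: c r => [|g c IH] r.
  by exists 1; rewrite /= (@step_config joining a b [::] r _ _ _ _ _ erefl) /= !seq_of_opt_ohead.
have [n nE] := IH (g :: r); exists n.+1.
rewrite iterSr (@step_config joining a b (g :: c) r _ _ _ _ _ erefl) /= !seq_of_opt_ohead nE.
by rewrite rev_cons cat_rcons.
Qed.

Lemma boot_run w : exists n,
  iter n step (config boot (map tape_letter w) [::] [::] [::]) =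
  config (running (tm_start M)) [::] [::] [::]
    (map tape_letter
       (w ++ flatten [seq quote (inr (tape_letter x)) | x <- w] ++ end_code)).
Proof.
set a := map tape_letter w; set e := map tape_letter end_code.
have [n1 E1] := copying_run a [::] [::] e.
have [n2 E2] := quoting_run [::] (rev a) (rev a) e.
have [n3 E3] := joining_run [::] [::] (rev a)
  (flatten [seq map tape_letter (quote (inr g)) | g <- a] ++ e).
exists (n3 + (n2 + n1.+1)).
have -> : iter (n3 + (n2 + n1.+1)) step (config boot a [::] [::] [::]) =
    iter n3 step (iter n2 step (iter n1 step (config copying a [::] [::] e))).
  rewrite !iterD iterSr (@step_config boot a [::] [::] [::] _ _ _ _ _ erefl).
  by rewrite !seq_of_opt_ohead cats0.
rewrite E1 !cats0 E2 revK E3 revK; congr (config _ _ _ _).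
by rewrite /a !map_cat map_flatten -!map_comp.
Qed.

(** * Simulation of [M] on two stacks *)

Definition simulates (l : {ffun stack -> seq stack_symbol}) (k : tm_config M) : Prop :=
  exists2 r, l = config (running (cfg_state k))
                   [seq cfg_tape k i | i <- rev (iota 0 (cfg_head k))] [::] [::] r
  & forall i, nth None r i = cfg_tape k (cfg_head k + i).

Lemma simulates_step l k : simulates l k -> simulates (step l) (tm_step k).
Proof.
case: k => q h tape [r -> /= tapeE]; rewrite /tm_step /=.
set a := [seq tape i | i <- rev (iota 0 h)].
(* Squares beyond the end of [r] are blank, so an empty right stack reads as [None]. *)
have headE : odflt None (ohead r) = tape h.
  by have := tapeE 0; rewrite addn0 => <-; case: (r).
have tailE i : nth None (behead r) i = tape (h + i.+1) by rewrite nth_behead.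
have revE j : rev (0 :: iota 1 j) = j :: rev (iota 0 j).
  by rewrite -[_ :: _]/(iota 0 j.+1) -addn1 iotaD rev_cat.
case vE: (tm_verdict q) => [v|].
  exists r => //; rewrite (step_config (q' := running q) (a' := seq_of_opt (ohead a))
    (b' := [::]) (c' := [::]) (r' := seq_of_opt (ohead r))) ?seq_of_opt_ohead //.
  by rewrite /= vE.
case dE: (tm_delta q (tape h)) => [[q' g] [|]] /=; last first.
  exists (behead r); last first.
    by move=> i /=; rewrite tailE addSnnS gtn_eqF // -[ltnLHS]addn0 ltn_add2l.
  rewrite (step_config (q' := running q') (a' := g :: seq_of_opt (ohead a))
    (b' := [::]) (c' := [::]) (r' := [::])) /=; last by rewrite vE headE dE.
  rewrite seq_of_opt_ohead /a revE /= eqxx; congr (config _ (_ :: _)).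
  by apply/eq_in_map => i; rewrite mem_rev mem_iota add0n => /andP[_ /ltn_eqF->].
(* At square 0 the left stack is empty and the head stays, so only the written symbol [g] goes back
   on the right stack. *)
case: h @a tapeE headE tailE dE => [|h] a tapeE headE tailE dE.
  exists (g :: behead r); last by case=> [|i] //=; rewrite tailE.
  by rewrite (step_config (q' := running q') (a' := [::])
    (b' := [::]) (c' := [::]) (r' := [:: g])) //= vE headE dE.
(* Otherwise the left neighbour is popped and placed above [g], under the new head. *)
exists (tape h :: g :: behead r); last first.
  case=> [|[|i]] /=; rewrite ?addn0 ?addn1 ?eqxx //; first by rewrite ltn_eqF.
  by rewrite tailE addSnnS gtn_eqF // !addnS !ltnS leq_addr.
rewrite /a [iota _ _]/= revE (step_config (q' := running q') (a' := [::])
  (b' := [::]) (c' := [::]) (r' := [:: tape h; g])) /=; last by rewrite vE headE dE.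
congr (config _ _ _ _).
apply/eq_in_map => i; rewrite mem_rev mem_iota add0n => /andP[_ lt_ih].
by rewrite ltn_eqF // ltnW.
Qed.

Lemma simulates_iter n l k :
  simulates l k -> simulates (iter n step l) (iter n (@tm_step _ M) k).
Proof. by move=> lk; elim: n => //= n; exact: simulates_step. Qed.

Lemma simulates_rejecting l k : simulates l k ->
  rejecting (tops l) = (tm_verdict (cfg_state k) == Some false).
Proof. by case=> r -> _; rewrite /rejecting !ffunE. Qed.

(** The instruction of a halted state puts every top back, so the control does not change. *)
Lemma rejecting_step l : rejecting (tops l) -> rejecting (tops (step l)).
Proof.
rewrite /rejecting ffunE; case lE: (ohead _) => [[[//|q]|//]|//] /eqP vE.
by rewrite !ffunE /program ffunE lE /= vE /= vE.
Qed.

(** * The self-referential sentence *)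

Definition context : body :=
  And (successor program rejecting 0 1)
      (Conj [seq stack_is s (words boot [::] [::] [::] [::] s) 2
            | s <- [:: control_stack; copy1_stack; copy2_stack; right_stack]]).

(** The [LAnd] before [context] already opens the conjunction of [diag_body]. *)
Definition context_code : seq letter :=
  LForall :: enc_nat 0 ++ LExists :: enc_nat 1 ++ LExists :: enc_nat 2 ++
  LAnd :: enc_body context.

Definition start : {ffun stack -> seq stack_symbol} :=
  config boot (map tape_letter context_code) [::] [::] [::].

(* The part that depends on [context_code] comes last, so that the code of
   [diag] is [context_code], its quotation and [end_code]. *)
Definition diag_body : body :=
  And context (stack_is left_stack (start left_stack) 2).

Definition diag : formula := Forall 0 (Exists 1 (Exists 2 (Body diag_body))).

Lemma diag_closed : nilp (free_vars diag).
Proof.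
have lt3 : all (gtn 3) (body_vars diag_body).
  by rewrite /= !all_cat body_vars_successor // !body_vars_stack_is.
rewrite /nilp /= -!filter_predI size_filter -leqn0 leqNgt -has_count.
by apply/hasPn => v /(allP lt3) /=; case: v => [|[|[|]]].
Qed.

Definition diag_sentence : sentence := exist _ diag diag_closed.

(** The fixed point: the last conjunct spells [context_code], so [enc_spells] codes it by the
    quotation of [context_code]; the whole is the word that [boot_run] leaves for [M]. *)
Lemma enc_diag : enc_formula diag =
  context_code ++
  flatten [seq quote (inr (tape_letter x)) | x <- context_code] ++ end_code.
Proof.
have enc_context p :
    enc_formula (Forall 0 (Exists 1 (Exists 2 (Body (And context p))))) =
    context_code ++ enc_body p.
  by rewrite /context_code; move: context => q /=.
rewrite enc_context /stack_is enc_spells ffunE -/end_code.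
by move: context_code => w; rewrite /words /left_stack -!map_comp.
Qed.

Lemma start_run : exists n, simulates (iter n step start)
  (tm_init M (enc_sentence diag_sentence)).
Proof.
have [n nE] := boot_run context_code; exists n.
rewrite /start nE -enc_diag.
by exists (map tape_letter (enc_sentence diag_sentence)).
Qed.

(** * Models of the sentence *)

Section Models.

Variables (V : Type) (B : bool -> V) (I : interpretation B) (init : nat -> V).

Definition assign3 (x y z : execution V) : assignment V :=
  assign (assign (assign (@empty_assignment V) 0 x) 1 y) 2 z.

Lemma modelsP (E : execution V -> Prop) :
  models I init E diag <-> forall x, E x -> exists y, E y /\ exists z, E z /\
    body_holds I init (assign3 x y z) 0 diag_body.
Proof. by []. Qed.

Lemma sat_diag_body x y z : body_holds I init (assign3 x y z) 0 diag_body <->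
  body_holds I init (assign3 x y z) 0 (successor program rejecting 0 1) /\
  (forall s, represents z s (start s)).
Proof.
have ze : assign3 x y z 2 = Some z by [].
rewrite 2!sat_And (sat_stack_is I init _ _ ze).
split=> [[[hs /sat_Conj_map hc] ha]|[hs h]].
  split=> // s.
  case: (eqVneq s left_stack) => [->//|sA].
  have -> : start s = words boot [::] [::] [::] [::] s.
    by rewrite ffunE; case: s sA => [[[] []]|].
  apply/(sat_stack_is I init _ _ ze); apply: hc.
  by case: s sA => [[[] []]|].
split=> //; split=> //; apply/sat_Conj_map => s; rewrite !inE => /or4P sE.
apply/(sat_stack_is I init _ _ ze); have := h s; rewrite ffunE.
by case: sE => /eqP->.
Qed.

Lemma sat_diag_successor x y z (l : {ffun stack -> seq stack_symbol}) :
  (forall s, represents x s (l s)) ->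
  body_holds I init (assign3 x y z) 0 (successor program rejecting 0 1) <->
  ~~ rejecting (tops l) /\ (forall s, represents y s (step l s)).
Proof. by move=> xl; apply: sat_successor. Qed.

(** Any element of [E] yields a start row as its [z]; from there the witnesses [y] follow the run
    step by step. *)
Lemma models_run (E : execution V -> Prop) e n : models I init E diag -> E e ->
  (exists2 x, E x & forall s, represents x s (iter n step start s)) /\
  ~~ rejecting (tops (iter n step start)).
Proof.
move=> /modelsP mE Ee.
have next m x : E x -> (forall s, represents x s (iter m step start s)) ->
    ~~ rejecting (tops (iter m step start)) /\
    exists2 y, E y & forall s, represents y s (iter m.+1 step start s).
  move=> /mE[y [Ey [z [_ /sat_diag_body[hs _]]]]] xl.
  by have [nr yl] := (sat_diag_successor y z xl).1 hs; split=> //; exists y.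
have row : exists2 x, E x & forall s, represents x s (iter n step start s).
  elim: n => [|n [x Ex xl]]; last by have [] := next n x Ex xl.
  by have [y [_ [z [Ez /sat_diag_body[_ zl]]]]] := mE _ Ee; exists z.
by split=> //; case: row => x Ex /(next _ _ Ex)[].
Qed.

Lemma models_rows v : (forall n, ~~ rejecting (tops (iter n step start))) ->
  models I init (fun e => exists n, e = trace_of v (iter n step start)) diag.
Proof.
move=> nr; apply/modelsP => x [n ->].
exists (trace_of v (iter n.+1 step start)); split; first by exists n.+1.
exists (trace_of v start); split; first by exists 0.
apply/sat_diag_body; split; last exact: trace_of_represents.
apply/sat_diag_successor; first exact: trace_of_represents.
by split=> // s; exact: trace_of_represents.
Qed.

(** The only candidate successor is [start] itself, but the first step turns the control from [boot]
    to [copying]. *)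
Lemma not_models_start v :
  ~ models I init (fun e => e = trace_of v start) diag.
Proof.
move=> /modelsP/(_ _ erefl)[y [-> [z [_]]]].
case/sat_diag_body => + _.
case/(sat_diag_successor _ _ (trace_of_represents v start)).
move=> _ /(_ control_stack)/(represents_inj (trace_of_represents v start _)).
by rewrite !(@step_config boot (map tape_letter context_code) [::] [::] [::] _ _ _ _ _ erefl) !ffunE.
Qed.

End Models.

End Diagonal.

(** * The diagonal argument *)

Lemma tm_verdict_stable (A : finType) (M : turing_machine A) w m n b :
  tm_verdict (cfg_state (iter m (@tm_step A M) (tm_init M w))) = Some b ->
  tm_verdict (cfg_state (iter (n + m) (@tm_step A M) (tm_init M w))) = Some b.
Proof. by move=> vE; elim: n => //= n IH; rewrite /tm_step IH. Qed.

Theorem theorem3 (V : Type) (B : bool -> V) (B_inj : injective B)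
    (init : nat -> V) :
  ~ tm_decidable enc_sentence
      (fun phi : sentence => pseudo_hyperproperty B init (sval phi)).
Proof.
case=> M decM; have [accP rejP] := decM (diag_sentence M).
have [n0 simM] := start_run M.
have rejM n : rejecting (tops (iter (n + n0) (stack_step (@program M)) (start M))) =
    (tm_verdict (cfg_state (iter n (@tm_step _ M)
       (tm_init M (enc_sentence (diag_sentence M))))) == Some false).
  by rewrite iterD (simulates_rejecting (simulates_iter n simM)).
have [psd|npsd] := classic (pseudo_hyperproperty B init (diag M)).
  have [n accE] := accP psd.
  (* A rejecting row would persist until after [M] has accepted. *)
  have nr k : ~~ rejecting (tops (iter k (stack_step (@program M)) (start M))).
    apply/negP => rk.
    have : rejecting (tops (iter ((n + k) + n0) (stack_step (@program M)) (start M))).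
      by rewrite addnAC; elim: (n + n0) => //= m; exact: rejecting_step.
    by rewrite rejM addnC (tm_verdict_stable k accE).
  pose I := @Interpretation V B (fun _ _ => B true) (fun _ _ => ex_intro _ true erefl).
  have [P PE] := psd I.
  (* The rows of the run form a model, hence lie in [P]; so the first row alone would be a model
     too. *)
  apply: (not_models_start (M := M) (I := I) (init := init) (v := init 0)).
  apply/PE => _ ->.
  by have /PE := @models_rows M V B I init (init 0) nr; apply; exists 0.
(* If [M] rejects, no nonempty set is a model, while the empty set is one by the leading universal
   quantifier; so the empty [P] works. *)
have [n rejE] := rejP npsd; apply: npsd => I; exists (fun=> False) => E.
split=> [mE e Ee|E0]; last by apply/modelsP => e /E0.
by have [_] := models_run (n + n0) mE Ee; rewrite rejM rejE.
Qed.
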